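(* Consider the online hiring problem with costs drawn i.i.d. from an arbitrary known continuous distribution $X$ on $[0,\infty)$ with $F(0)=0$, and let $\delta_q$ denote the $q$-quantile of $X$ ($\mathbf{P}[x\le\delta_q]=q$). The following online algorithm (Algorithm 3) is $6.052$-competitive. Initialize $q\leftarrow 1$, $\tau\leftarrow\delta_q$, $t\leftarrow 1$. For $i=1,\dots,n$: set $t\leftarrow t-1$; if $x_i\le\tau$, then while $x_i\le\tau$ set $q\leftarrow q/2$ and $\tau\leftarrow\delta_q$; afterwards, if $i+2/q>n$, hire applicant $i$ until time $n$ (i.e. for $n-i+1$ time steps) and stop; otherwise hire applicant $i$ for $2/q$ time steps and set $t\leftarrow 1/q$; else, if $t=0$, set $q\leftarrow 2q$, $\tau\leftarrow\delta_q$, $t\leftarrow 1/q$.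
   Context: Online hiring problem: there are $n$ time steps; in time step $i$ applicant $i$ arrives and its cost $x_i$ is revealed, where $x_1,\dots,x_n$ are drawn independently from a distribution $X$. Immediately and irrevocably at time $i$, based only on $x_1,\dots,x_i$ and earlier decisions, the algorithm chooses a nonnegative integer duration $t_i$; applicant $i$ is then under contract during time steps $i,\dots,i+t_i-1$. At every time step $s\in\{1,\dots,n\}$ at least one applicant must be under contract. The cost is $\sum_i t_ix_i$; $\textsc{Alg}_n$ denotes the cost of the online algorithm and $\textsc{Opt}_n$ the minimum cost of a feasible solution knowing all $x_1,\dots,x_n$ in advance. An algorithm is $c$-competitive if $\limsup_{n\to\infty}\mathbf{E}[\textsc{Alg}_n]/\mathbf{E}[\textsc{Opt}_n]\le c$. *)

(* Defs.v *)
From HB Require Import structures.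
From mathcomp Require Import all_boot all_order all_algebra.
From mathcomp Require Import all_classical all_reals all_analysis.

Set Implicit Arguments.
Unset Strict Implicit.
Unset Printing Implicit Defensive.

Import Order.TTheory GRing.Theory Num.Theory.
Import numFieldNormedType.Exports.

Local Open Scope classical_set_scope.
Local Open Scope ring_scope.

(* Applicants and time steps are numbered from 1: a cost sequence x and a
   duration sequence t are only ever read at indices 1, ..., n. *)
Section hiring.
Context {R : realType}.
Implicit Types (n i s : nat) (x t : nat -> R).

(* Durations are kept in R so that 2 / q below can be read literally; their
   integrality is part of feasibility. *)
Definition feasible n t : Prop :=
  (forall i, (1 <= i <= n)%N -> t i \is a Num.nat) /\
  (forall s, (1 <= s <= n)%N ->
     exists2 i, (1 <= i <= s)%N & s%:R <= i%:R + t i - 1).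

Definition cost n x t : R := \sum_(1 <= i < n.+1) t i * x i.

Definition opt n x : R := inf [set cost n x t | t in feasible n].

(* From the horizon n and the revealed costs [:: x_1; ...; x_i], the duration
   of the contract offered to applicant i. *)
Definition online_algorithm := nat -> seq R -> R.

Definition durations (A : online_algorithm) n x : nat -> R :=
  fun i => A n [seq x j | j <- iota 1 i].

Definition alg (A : online_algorithm) n x : R := cost n x (durations A n x).

End hiring.

Section while_loop.
Context {S : Type}.

(* If the loop does not terminate, xget returns its default 0 and the state is
   left unchanged. *)
Definition while_loop (b : S -> bool) (f : S -> S) (s : S) : S :=
  iter (xget 0%N [set j | ~~ b (iter j f s) /\
                          forall k, (k < j)%N -> b (iter k f s)]) f s.

End while_loop.

Section algorithm3.
Context {R : realType}.

(* The threshold tau of the algorithm always equals delta q, so it is not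
   stored. [hired] is the duration given to the last applicant, numbered
   [time] (0 if that applicant is not hired). *)
Record state := State {
  time : nat; q_of : R; t_of : R; stopped : bool; hired : R }.

Definition init : state := State 0 1 1 false 0.

Definition step (delta : R -> \bar R) (n : nat) (st : state) (x : R) : state :=
  let i := (time st).+1 in
  let q := q_of st in
  if stopped st then State i q (t_of st) true 0
  else
    let t := t_of st - 1 in
    if (x%:E <= delta q)%E then
      let q' := while_loop (fun p => (x%:E <= delta p)%E) (fun p => p / 2) q in
      if n%:R < i%:R + 2 / q' then State i q' t true (n%:R - i%:R + 1)
      else State i q' (1 / q') false (2 / q')
    else if t == 0 then State i (2 * q) (1 / (2 * q)) false 0
    else State i q t false 0.

Definition algorithm3 (delta : R -> \bar R) : online_algorithm :=
  fun n xs => hired (foldl (step delta n) init xs).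

End algorithm3.

Section competitiveness.
Context d (T : measurableType d) (R : realType) (P : probability T R).

(* The duration sequences produced by A must be feasible almost surely. *)
Definition as_feasible (x : nat -> {RV P >-> R}) (A : online_algorithm) : Prop :=
  forall n, {ae P, forall w, feasible n (durations A n (fun i => x i w))}.

(* E[Opt_n] > 0 for n > 0 whenever the costs are positive almost surely. If the
   costs have infinite mean, both expectations are +oo and the quotient is 0. *)
Definition competitive (x : nat -> {RV P >-> R}) (A : online_algorithm) (c : R)
    : Prop :=
  (limn_esup (fun n => 'E_P[fun w => alg A n (fun i => x i w)] /
                       'E_P[fun w => opt n (fun i => x i w)]) <= c%:E)%E.

Definition iid (X : probability R R) (x : nat -> {RV P >-> R}) : Prop :=
  (forall i, (0 < i)%N -> forall B : set R, measurable B ->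
     distribution P (x i) B = X B) /\
  (forall n (B : nat -> set R), (forall i, measurable (B i)) ->
     P (\bigcap_(i in [set i | (1 <= i <= n)%N]) (x i @^-1` B i)) =
     (\prod_(1 <= i < n.+1) P (x i @^-1` B i))%E).

End competitiveness.

Section quantiles.
Context {R : realType}.

Definition distribution_function (X : probability R R) (r : R) : \bar R :=
  X `]-oo, r]%classic.

(* Quantiles are extended reals because the 1-quantile of a distribution with
   unbounded support is +oo. Where the distribution function is flat, any
   choice of quantile is allowed. *)
Definition is_quantile (X : probability R R) (delta : R -> \bar R) : Prop :=
  forall q : R, 0 < q <= 1 -> X [set r | (r%:E <= delta q)%E] = q%:E.

End quantiles.

(* Main.v *)
Require Import Defs.
From HB Require Import structures.
From mathcomp Require Import all_boot all_order all_algebra.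
From mathcomp Require Import all_classical all_reals all_analysis.
From mathcomp Require Import measurable_realfun ring lra zify.

(** By the layer-cake formula it is enough to bound, for each [r], the expected
    total duration [D r] of the contracts with cost above [r] by the expected
    number of time steps at which no cost at most [r] has been seen, which is
    [sum_(1 <= s <= n) (1 - v) ^ s] for [v = F r].

    Write [q = 2 ^- l] and call [l] the level.  A level with a fresh timer fails
    with probability [(1 - 2 ^- l) ^ (2 ^ l) <= 2 / 5], and an accepted applicant
    moves the level down to class [k] with probability proportional to [2 ^- k].
    At failure probability exactly [2 / 5] the walk hires each class [3 / 4] times
    in expectation, and the chance to return one level up is [1 / 2]; this gives
    an explicit potential whose value at the start bounds [D r].  With
    [K = 2 ^ k], [1 / K <= v <= 2 / K], the bound is
    [3 / 4 * (6 K - 2 K ^ 2 v - 4)]; merging all classes too long to fit in the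
    horizon gives [5 / 2 * n].  The better of the two is at most [6.052] times
    the geometric sum, the critical case being [v] close to [1]. *)

Set Implicit Arguments.
Unset Strict Implicit.
Unset Printing Implicit Defensive.

Import Order.TTheory GRing.Theory Num.Theory.
Import numFieldNormedType.Exports.

Local Open Scope classical_set_scope.
Local Open Scope ring_scope.

(** * The walk on levels and its potential *)

(* [Some (l, t)] is the running state with [q = 2 ^- l] and timer [t]; [None] is
   the stopped state. *)
Definition astate := option (nat * nat).

Definition anext (n i : nat) (s : astate) (k : nat) : astate :=
  if s is Some (l, t) then
    if (l < k)%N then if (n < i + 2 ^ k.+1)%N then None else Some (k, 2 ^ k)%N
    else if t == 1%N then Some (l.-1, 2 ^ l.-1)%N else Some (l, t.-1)
  else None.

Definition aduration (n i : nat) (s : astate) (k : nat) : nat :=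
  if s is Some (l, _) then
    if (l < k)%N then if (n < i + 2 ^ k.+1)%N then (n - i).+1 else (2 ^ k.+1)%N
    else 0%N
  else 0%N.

(* Level [M] is never reached: such a contract exceeds the horizon. *)
Definition valid (M : nat) (s : astate) : bool :=
  if s is Some (l, t) then [&& l < M, 0 < t & t <= 2 ^ l]%N else true.

(** A hire that fits in the horizon has [2 ^ k.+1 < 2 ^ M.+1], hence [k < M]. A rejection has
    [0 < k <= l], so level [l.-1] really lies one step up. *)
Lemma anext_valid (M n i : nat) (s : astate) (k : nat) :
  (n <= 2 ^ M.+1)%N -> (0 < i)%N -> valid M s ->
  (0 < k)%N -> valid M (anext n i s k).
Proof.
case: s => [[l t]|//] nM i0 /= /and3P[lM t0 tl] k0.
case: ltnP => [lk|kl].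
  case: ltnP => //= nk; rewrite expn_gt0 leqnn !andbT.
  by rewrite -ltnS -(ltn_exp2l _ _ (ltnSn 1)); lia.
have l0 : (0 < l)%N by lia.
case: ifP => /eqP t1 /=; first by rewrite expn_gt0 leqnn; lia.
by lia.
Qed.

Section potential.
Context {R : realFieldType}.
Implicit Types (w : nat -> R).

(** After a shift of [m], the power is the inverse of [(1 + 1 / m) ^ (m + 1)], which three binomial
    terms bound below by [5 / 2 + 3 / (2 m)]. *)
Lemma exp_one_minus_inv_le (m : nat) :
  (1 < m)%N -> (1 - m%:R^-1) ^+ m <= 2 / 5 :> R.
Proof.
case: m => [//|m]; rewrite ltnS => m0.
have m0' : 0 < m%:R :> R by rewrite ltr0n.
have h k : (1 + m%:R^-1) ^+ k >=
    1 + k%:R / m%:R + k%:R * (k%:R - 1) / 2 / m%:R ^+ 2 :> R.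
  elim: k => [|k IH]; first by rewrite expr0; lra.
  have x0 : 0 <= 1 + m%:R^-1 :> R by rewrite addr_ge0// invr_ge0 ler0n.
  rewrite [in leRHS]exprSr; apply: le_trans (ler_wpM2r x0 IH).
  rewrite -natr1 -subr_ge0.
  set x := m%:R^-1; set y := k%:R.
  have -> : (1 + y / m%:R + y * (y - 1) / 2 / m%:R ^+ 2) * (1 + x) -
    (1 + (y + 1) / m%:R + (y + 1) * (y + 1 - 1) / 2 / m%:R ^+ 2) =
    (y * (y - 1)) / 2 * x ^+ 3 by rewrite /x; field; lra.
  rewrite mulr_ge0 ?exprn_ge0 ?invr_ge0 ?ler0n// divr_ge0//.
  rewrite /y; case: k {IH y} => [|k]; first by rewrite mul0r.
  by rewrite -natr1 addrK mulr_ge0// addr_ge0.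
have -> : 1 - m.+1%:R^-1 = (1 + m%:R^-1)^-1 :> R.
  by rewrite -natr1; field; apply/andP; split; apply/eqP; lra.
have h5 : 5 / 2 <= (1 + m%:R^-1) ^+ m.+1 :> R.
  apply: le_trans (h m.+1); rewrite -(natr1 m) -subr_ge0.
  have -> : 1 + (m%:R + 1) / m%:R + (m%:R + 1) * (m%:R + 1 - 1) / 2 / m%:R ^+ 2
    - 5 / 2 = 3 / 2 * m%:R^-1 :> R by field; lra.
  by rewrite mulr_ge0 ?invr_ge0//; lra.
have /le_trans : (1 + m%:R^-1) ^- m.+1 <= (5 / 2)^-1 :> R.
  by rewrite lef_pV2// posrE ?exprn_gt0 ?addr_gt0 ?invr_gt0//; lra.
by rewrite exprVn; apply; lra.
Qed.

(* [w k] is the probability of class [k] with cost above [r], and [dcoef w k] is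
   the expected counted duration [2 ^ k.+1 * (w k / 2 ^- k)] of a class-[k] hire.
   The class [M] collects all deeper ones; it always stops the algorithm. *)
Definition dcoef w k : R := 2 ^+ (k + k).+1 * w k.

Definition upsum w (M l : nat) : R := \sum_(l.+1 <= k < M) dcoef w k.

(** Unfolds to the sum of [dcoef w j / 2 ^ (l + 1 - j)] over [1 <= j <= l]: from level [l], hiring
    class [j] first requires [l + 1 - j] returns by one level, each of chance [1 / 2]. *)
Fixpoint downsum w (l : nat) : R :=
  if l is l'.+1 then (downsum w l' + dcoef w l) / 2 else 0.

(** Class [M] has probability [2 ^- M.-1], so [2 ^ M.-1 * w M] is the conditional probability that
    its cost is above [r]; its contract lasts at most [n] steps. *)
Definition topcost w (M n : nat) : R := n%:R * 2 ^+ M.-1 * w M.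

Definition fresh w (M n l : nat) : R :=
  3 / 4 * (upsum w M l + downsum w l) + topcost w M n.

Definition accept w (M n l : nat) : R :=
  3 / 4 * upsum w M l + 1 / 4 * downsum w l + topcost w M n.

(** For [0 < l] this solves [v t = 2 ^- l * accept + (1 - 2 ^- l) * v t.-1], where [accept] is the
    value once an applicant is accepted and [v 0] is [fresh] at level [l.-1]. *)
Definition potential w (M n : nat) (s : astate) : R :=
  if s is Some (l, t) then
    accept w M n l + 5 / 4 * downsum w l * (1 - 2 ^- l) ^+ t
  else 0.

Section fixed.
Variables (w : nat -> R) (M n : nat).
Hypotheses (w_ge0 : forall k, 0 <= w k) (M_gt0 : (0 < M)%N)
  (n_le : (n <= 2 ^ M.+1)%N).

Lemma dcoef_ge0 k : 0 <= dcoef w k.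
Proof. by rewrite mulr_ge0// exprn_ge0. Qed.

Lemma downsum_ge0 l : 0 <= downsum w l.
Proof. by elim: l => //= l IH; rewrite divr_ge0// addr_ge0// dcoef_ge0. Qed.

Lemma upsum_ge0 l : 0 <= upsum w M l.
Proof. by apply: sumr_ge0 => k _; exact: dcoef_ge0. Qed.

Lemma topcost_ge0 : 0 <= topcost w M n.
Proof. by rewrite !mulr_ge0// exprn_ge0. Qed.

Lemma accept_ge0 l : 0 <= accept w M n l.
Proof.
have := upsum_ge0 l; have := downsum_ge0 l; have := topcost_ge0.
by rewrite /accept; lra.
Qed.

Lemma fresh_ge0 l : 0 <= fresh w M n l.
Proof.
have := upsum_ge0 l; have := downsum_ge0 l; have := topcost_ge0.
by rewrite /fresh; lra.
Qed.

Lemma pow_half_le1 l : 0 <= 1 - 2 ^- l :> R.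
Proof. by rewrite subr_ge0 invf_le1 ?exprn_gt0// exprn_ege1// ler1n. Qed.

Lemma potential_ge0 s : 0 <= potential w M n s.
Proof.
case: s => [[l t]|//] /=; rewrite addr_ge0 ?accept_ge0// mulr_ge0//.
  by rewrite mulr_ge0 ?downsum_ge0//; lra.
by rewrite exprn_ge0// pow_half_le1.
Qed.

Lemma upsumS l : (l.+1 < M)%N ->
  upsum w M l = dcoef w l.+1 + upsum w M l.+1.
Proof. by move=> lM; rewrite /upsum big_ltn. Qed.

(** At [t = 2 ^ l] the power is at most [2 / 5], and [1 / 4 + 5 / 4 * 2 / 5 = 3 / 4]. At level 0
    [downsum] vanishes. *)
Lemma potential_fresh l : potential w M n (Some (l, 2 ^ l)%N) <= fresh w M n l.
Proof.
rewrite /= /accept /fresh; case: l => [|l]; first by rewrite /=; lra.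
have := @exp_one_minus_inv_le (2 ^ l.+1).
rewrite natrX -[X in (X < _)%N](expn0 2) ltn_exp2l// => /(_ isT).
set z := (_ ^+ _); set b := downsum w l.+1 => hz.
have b0 : 0 <= b by exact: downsum_ge0.
have := ler_wpM2l b0 hz.
by lra.
Qed.

(* The weights [3/4] and [1/4] make this an equality when [l.+1 < M]. *)
Lemma accept_sum_le l : (l < M)%N ->
  \sum_(l.+1 <= k < M) (w k * 2 ^+ k.+1 + 2 ^- k * fresh w M n k) + w M * n%:R
  <= 2 ^- l * accept w M n l.
Proof.
(* Downward induction on the level from [M.-1], by way of [j = M - l]. *)
move=> lM; rewrite -(subKn (ltnW lM)); have : (0 < M - l)%N by rewrite subn_gt0.
move: (M - l)%N => j {l lM}; elim: j => // -[_ _|j IH _].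
  rewrite subn1 prednK// big_geq// add0r /accept /topcost.
  rewrite /upsum prednK// big_geq// mulr0 add0r.
  have := downsum_ge0 M.-1; set b := downsum _ _ => b0.
  rewrite mulrDr [X in _ + X](_ : _ = w M * n%:R); last first.
    by field; rewrite expf_neq0//; lra.
  by rewrite lerDr !mulr_ge0// ?invr_ge0 ?exprn_ge0//; lra.
(* For [M <= j.+1] both truncated differences are 0, and the claim is the induction hypothesis. *)
have [jM|Mj] := ltnP j.+1 M; last first.
  have /IH : (0 < j.+1)%N by [].
  by rewrite (_ : M - j.+2 = M - j.+1)%N//; lia.
rewrite (_ : M - j.+1 = (M - j.+2).+1)%N in IH; last by lia.
have lM : ((M - j.+2).+1 < M)%N by lia.
move: (M - j.+2)%N lM IH => l lM /(_ isT) IH.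
rewrite big_ltn// -addrA; apply: le_trans (lerD (lexx _) IH) _.
rewrite /fresh /accept (upsumS lM) /= /dcoef.
set u := upsum _ _ _; set b := downsum _ _; set e := topcost _ _ _.
rewrite le_eqVlt; apply/orP; left; apply/eqP.
rewrite addSn addnS !exprS exprD.
by field; rewrite expf_neq0//; lra.
Qed.

Variable pk : nat -> R.
Hypotheses (pk_low : forall k, (0 < k < M)%N -> pk k = 2 ^- k)
  (pk_0 : pk 0%N = 0).

(** [pk k] is the probability of class [k]; the classes up to [l] are exactly those rejected at
    level [l]. *)
Lemma pk_sum l : (l < M)%N -> \sum_(0 <= k < l.+1) pk k = 1 - 2 ^- l.
Proof.
elim: l => [_|l IH lM]; first by rewrite big_nat1 pk_0 expr0 invr1 subrr.
rewrite big_nat_recr//= IH ?(ltnW lM)// pk_low// exprS.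
by field; rewrite expf_neq0//; lra.
Qed.

Lemma fresh_pred l : (0 < l < M)%N ->
  fresh w M n l.-1 = accept w M n l + 5 / 4 * downsum w l.
Proof.
case: l => // l lM; rewrite /fresh /accept (upsumS lM) /=.
by field.
Qed.

Lemma reject_le (i l t k : nat) :
  (0 < l < M)%N -> (k <= l)%N ->
  potential w M n (anext n i (Some (l, t)) k) <=
  accept w M n l + 5 / 4 * downsum w l * (1 - 2 ^- l) ^+ t.-1.
Proof.
move=> lM kl; rewrite /anext ltnNge kl /=; case: ifPn => [/eqP ->|//] /=.
by rewrite expr0 mulr1 -fresh_pred//; exact: potential_fresh.
Qed.

Lemma accept_le (i l t k : nat) : (0 < i)%N -> (l < k < M)%N ->
  w k * (aduration n i (Some (l, t)) k)%:R +
     pk k * potential w M n (anext n i (Some (l, t)) k) <=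
  w k * 2 ^+ k.+1 + 2 ^- k * fresh w M n k.
Proof.
move=> i0 /andP[lk kM]; rewrite pk_low ?kM ?(leq_ltn_trans _ lk)// lerD//.
  rewrite ler_wpM2l// -natrX ler_nat /= lk; case: ifP => // nk.
  by lia.
rewrite ler_wpM2l ?invr_ge0 ?exprn_ge0// /anext lk; case: ifP => // _.
  exact: fresh_ge0.
exact: potential_fresh.
Qed.

(** Supermartingale property: the expected counted duration at step [i] is paid for by the drop of
    the potential. Classes up to [l] are rejections, the larger ones hires. *)
Lemma potential_step (i : nat) (s : astate) : (0 < i <= n)%N -> valid M s ->
  \sum_(0 <= k < M.+1) (w k * (aduration n i s k)%:R +
     pk k * potential w M n (anext n i s k)) <= potential w M n s.
Proof.
move=> /andP[i0 i_n]; case: s => [[l t]|_]; last first.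
  by rewrite big1// => k _ /=; rewrite !mulr0 addr0.
move=> /and3P[lM t0 tl].
rewrite (big_cat_nat _ _ (n := l.+1))//; last by rewrite ltnS ltnW.
(* This middle term equals the potential: the [accept] parts add up to one, and the extra factor
   [1 - 2 ^- l] restores the power [t]. *)
apply: (@le_trans _ _ ((1 - 2 ^- l) *
    (accept w M n l + 5 / 4 * downsum w l * (1 - 2 ^- l) ^+ t.-1) +
    2 ^- l * accept w M n l)); last first.
  rewrite /= -[in leRHS](prednK t0) exprS.
  by rewrite le_eqVlt; apply/orP; left; apply/eqP; ring.
apply: lerD.
  rewrite -(pk_sum lM) mulr_suml; apply: ler_sum_nat => k /andP[_ kl].
  have lk : (l < k)%N = false by rewrite ltnNge -ltnS kl.
  rewrite {1}/aduration lk mulr0 add0r; have [k0|k0] := posnP k; first by rewrite k0 pk_0 !mul0r.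
  have l0 : (0 < l)%N by rewrite (leq_trans k0).
  apply: ler_wpM2l.
    by rewrite pk_low ?invr_ge0 ?exprn_ge0// k0 (leq_ltn_trans _ lM).
  by rewrite pk_sum//; apply: reject_le => //; rewrite l0.
apply: le_trans (accept_sum_le lM); rewrite big_nat_recr//=.
apply: lerD.
  by apply: ler_sum_nat => k; exact: accept_le.
have nM : (n < i + 2 ^ M.+1)%N.
  by rewrite (leq_ltn_trans n_le)// -[X in (X < _)%N]add0n ltn_add2r.
by rewrite lM nM mulr0 addr0 ler_wpM2l// ler_nat; lia.
Qed.

End fixed.
End potential.

(** * Numerical bounds *)

Section numeric_bounds.
Context {R : realFieldType}.
Implicit Types (v : R) (w : nat -> R) (M n k : nat).

Definition geom v n : R := \sum_(1 <= s < n.+1) (1 - v) ^+ s.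

Lemma geom_mul v n : v * geom v n = (1 - v) * (1 - (1 - v) ^+ n).
Proof.
rewrite /geom; elim: n => [|n IH]; first by rewrite big_geq// expr0 subrr !mulr0.
by rewrite big_nat_recr// mulrDr IH [in RHS]exprS exprS; ring.
Qed.

Lemma geom_ge1 v n : v <= 1 -> (0 < n)%N -> 1 - v <= geom v n.
Proof.
move=> v1 n0; rewrite /geom big_ltn// expr1 lerDl sumr_ge0// => s _.
by rewrite exprn_ge0// subr_ge0.
Qed.

Lemma geom_le v n : 0 <= v <= 1 -> geom v n <= n%:R.
Proof.
move=> /andP[v0 v1].
have -> : n%:R = \sum_(1 <= s < n.+1) 1 :> R.
  by rewrite sumr_const_nat subSS subn0.
by apply: ler_sum_nat => s _; rewrite exprn_ile1//; lra.
Qed.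

(* AM-GM on the pairs of exponents [s] and [n.+1 - s]. *)
Lemma geom_ge_lin v n : 0 <= v <= 1 / 2 -> 2 / 5 <= (1 - v) ^+ n ->
  11 / 25 * n%:R <= geom v n.
Proof.
move=> /andP[v0 v1] z.
have x0 : 0 <= 1 - v by lra.
suff : 2 * (11 / 25 * n%:R) <= geom v n + geom v n by lra.
have -> : 2 * (11 / 25 * n%:R) = \sum_(1 <= s < n.+1) (22 / 25 : R).
  by rewrite sumr_const_nat subSS subn0 -[RHS]mulr_natr; ring.
rewrite /geom [X in _ <= _ + X]big_nat_rev -big_split /=.
apply: ler_sum_nat => s /andP[s0 sn].
set a := (_ ^+ s); set b := (X in _ + X).
have a0 : 0 <= a by exact: exprn_ge0.
have b0 : 0 <= b by exact: exprn_ge0.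
have ab : 1 / 5 <= a * b.
  rewrite /a /b -exprD [X in _ ^+ X](_ : _ = n.+1); last by lia.
  rewrite exprS; set y := _ ^+ n in z *; set x := 1 - v in x0 *.
  have x2 : 1 / 2 <= x by rewrite /x; lra.
  by nra.
(* [(a + b) ^ 2 >= 4 * a * b >= 4 / 5], and [22 / 25] is below the square root of [4 / 5]. *)
by have := sqr_ge0 (a - b); rewrite -subr_ge0 => ?; nra.
Qed.

(** [Num.max (2 ^- k) v] is the probability of a class above [k] or a cost at most [r], two nested
    events. Consecutive differences leave class [k] with cost above [r]. *)
Definition is_class_weight v M w :=
  (forall k, (0 < k < M)%N -> w k = Num.max (2 ^- k.-1) v - Num.max (2 ^- k) v) /\
  w M = Num.max (2 ^- M.-1) v - v.

Lemma half_pow_le k l : (k <= l)%N -> 2 ^- l <= 2 ^- k :> R.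
Proof. by move=> kl; rewrite lef_pV2 ?posrE ?exprn_gt0// ler_weXn2l// ler1n. Qed.

Lemma half_pow_gt0 k : 0 < 2 ^- k :> R.
Proof. by rewrite invr_gt0 exprn_gt0. Qed.

Lemma class_weight_le v M w k : is_class_weight v M w -> (0 < k < M)%N ->
  w k <= 2 ^- k.
Proof.
move=> [wE _] kM; rewrite wE//; case: k kM => // k _ /=.
have -> : 2 ^- k = 2 * 2 ^- k.+1 :> R.
  by rewrite exprS; field; rewrite expf_neq0 ?pnatr_eq0.
have := half_pow_gt0 k.+1; set h := 2 ^- _ => h0.
by rewrite !maxEle; case: ifP; case: ifP; lra.
Qed.

Lemma class_weight_top_le v M w : 0 <= v -> is_class_weight v M w ->
  w M <= 2 ^- M.-1.
Proof.
move=> v0 [_ ->]; have := half_pow_gt0 M.-1; set h := 2 ^- _ => h0.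
by rewrite !maxEle; case: ifP; lra.
Qed.

Lemma potential_init w M n :
  potential w M n (Some (0, 1)%N) = 3 / 4 * upsum w M 0 + topcost w M n.
Proof. by rewrite /= /accept /=; lra. Qed.

Lemma upsum_geometric w M m : (0 < m <= M)%N ->
  (forall k, (0 < k < m)%N -> w k = 2 ^- k) ->
  \sum_(1 <= k < m) dcoef w k = 2 ^+ m.+1 - 4.
Proof.
move=> /andP[]; elim: m => // -[_ _ _ _|m IH _ mM wE].
  by rewrite big_geq// expr2; lra.
rewrite big_nat_recr//= IH//; [|exact: ltnW|]; last first.
  by move=> k km; apply: wE; lia.
rewrite /dcoef wE ?ltnSn// addSn addnS !exprS exprD.
by field; rewrite expf_neq0 ?pnatr_eq0.
Qed.

(** Classes below [k0] count in full, those above it have weight 0, and class [k0] keeps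
    [2 ^- k0.-1 - v]. *)
Lemma potential_init_high v M w n k0 : is_class_weight v M w ->
  (0 < k0 < M)%N -> 2 ^- k0 <= v <= 2 ^- k0.-1 ->
  potential w M n (Some (0, 1)%N) =
  3 / 4 * (6 * 2 ^+ k0 - 2 * (2 ^+ k0) ^+ 2 * v - 4).
Proof.
move=> [wE wM] /andP[k00 k0M] /andP[k0v vk0]; rewrite potential_init.
have mulow k : (k < k0)%N -> Num.max (2 ^- k) v = 2 ^- k.
  by move=> kk; apply/max_idPl; rewrite (le_trans vk0)// half_pow_le//; lia.
have muhigh k : (k0 <= k)%N -> Num.max (2 ^- k) v = v.
  by move=> kk; apply/max_idPr; rewrite (le_trans _ k0v)// half_pow_le.
have -> : topcost w M n = 0.
  by rewrite /topcost wM muhigh ?subrr ?mulr0//; lia.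
rewrite addr0; congr (_ * _).
rewrite /upsum (big_cat_nat _ _ (n := k0))//=; last exact: ltnW.
rewrite (@upsum_geometric _ M)//; first last.
- move=> k /andP[k1 kk]; rewrite wE ?k1 ?(ltn_trans kk)// !mulow//; last lia.
  case: k k1 {kk} => // k _ /=; rewrite exprS.
  by field; rewrite expf_neq0 ?pnatr_eq0.
- by rewrite k00 ltnW.
rewrite big_ltn// [X in _ + (_ + X)]big_nat big1 ?addr0; last first.
  move=> k /andP[kk kM]; rewrite /dcoef wE ?muhigh ?subrr ?mulr0//; lia.
rewrite /dcoef wE ?k00// (muhigh k0)// (mulow k0.-1) ?prednK//.
case: k0 k00 {k0M k0v vk0 mulow muhigh} => // k _ /=.
rewrite addSn addnS !exprS exprD.
by field; rewrite expf_neq0 ?pnatr_eq0.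
Qed.

(** Counting every class in full, [2 ^ M < n] bounds [upsum] by [2 * n], which contributes
    [3 / 2 * n]; [topcost] adds at most [n]. For [M = 1] the sum [upsum] is empty. *)
Lemma potential_init_lin v M w n : 0 <= v -> (0 < M)%N ->
  ((1 < M)%N -> (2 ^ M < n)%N) -> (forall k, 0 <= w k) ->
  is_class_weight v M w -> potential w M n (Some (0, 1)%N) <= 5 / 2 * n%:R.
Proof.
move=> v0 M0 Mn w0 wP; rewrite potential_init.
have up : upsum w M 0 <= 2 ^+ M.+1 - 4.
  rewrite -(@upsum_geometric (fun k => 2 ^- k) M M) ?M0 ?leqnn//.
  apply: ler_sum_nat => k kM; rewrite ler_wpM2l ?exprn_ge0//.
  exact: class_weight_le wP kM.
have top : topcost w M n <= n%:R.
  rewrite /topcost -mulrA ler_piMr//.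
  have := ler_wpM2l (exprn_ge0 M.-1 (ler0n R 2)) (class_weight_top_le v0 wP).
  by rewrite divff// expf_neq0//; lra.
have [M1|M1] := ltnP 1 M.
  have : (2 ^ M)%:R <= n%:R :> R by rewrite ler_nat ltnW// Mn.
  by move: up; rewrite natrX exprS; move: (2 ^+ M) => h; lra.
have n0 := ler0n R n.
have M1' : M = 1%N by lia.
by move: up top; rewrite M1' expr2; lra.
Qed.

Lemma competitive_bound v n : 0 <= v <= 1 -> (0 < n)%N ->
  exists M, [/\ (0 < M)%N, (n <= 2 ^ M.+1)%N &
    forall w, (forall k, 0 <= w k) -> is_class_weight v M w ->
      potential w M n (Some (0, 1)%N) <= (6 + 52 / 1000) * geom v n].
Proof.
move=> /andP[v0 v1] n0.
have [v2|v2] := leP (1 / 2) v.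
  exists n.+1; split => // [|w w0 wP].
    by rewrite ltnW// (leq_trans (ltn_expl n (ltnSn 1)))// leq_exp2l//; lia.
  (* With [K = 2] the bound is [6 * (1 - v)], and already the first term of [geom] is [1 - v]. *)
  rewrite (potential_init_high (k0 := 1) _ wP)//; last first.
    by rewrite expr0 expr1 invr1; lra.
  rewrite expr1; have := geom_ge1 v1 n0; lra.
have [z|z] := leP ((1 - v) ^+ n) (2 / 5).
  have exk : exists k, 2 ^- k <= v :> R.
    exists n.+1.
    (* Bernoulli's inequality and [(1 - v) ^+ n <= 2 / 5] even give [n * v >= 3 / 5]. *)
    have nv : 1 / 2 <= n%:R * v.
      have : 1 - n%:R * v <= (1 - v) ^+ n.
        elim: n {n0 z} => [|n IH]; first by rewrite expr0; lra.
        have v1' : 0 <= 1 - v by lra.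
        rewrite exprS; apply: le_trans (ler_wpM2l v1' IH).
        by rewrite -natr1; have := mulr_ge0 (ler0n R n) (sqr_ge0 v); lra.
      by move: z; set y := _ ^+ n; lra.
    rewrite -[leLHS]mul1r ler_pdivrMr ?exprn_gt0// exprS.
    have : n%:R <= 2 ^+ n :> R by rewrite -natrX ler_nat ltnW// ltn_expl.
    by move/(ler_wpM2r v0); move: (2 ^+ n) => h; lra.
  have [k0 k0v k0min] := ex_minnP exk.
  have k02 : (1 < k0)%N.
    case: k0 k0v {k0min} => [|[|//]]; first by rewrite expr0 invr1; lra.
    by rewrite expr1; lra.
  exists (k0 + n)%N; split => // [||w _ wP]; first by lia.
    rewrite ltnW// (leq_trans (ltn_expl n (ltnSn 1)))// leq_exp2l//; lia.
  have vk0 : v <= 2 ^- k0.-1.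
    by rewrite leNgt; apply/negP => /ltW/k0min; lia.
  rewrite (potential_init_high (k0 := k0) _ wP)//; [|lia|exact/andP].
  have vgt0 : 0 < v by exact: lt_le_trans (half_pow_gt0 _) k0v.
  (* Multiplying by [v] gives access to the closed form of [geom], whose factor [1 - (1 - v) ^+ n]
     is at least [3 / 5]. *)
  rewrite -(ler_pM2l vgt0) [leRHS]mulrCA geom_mul.
  have hK : 4 <= 2 ^+ k0 :> R.
    by rewrite -natrX ler_nat (@leq_exp2l 2 2).
  have K1 : 1 <= 2 ^+ k0 * v.
    have := ler_wpM2l (exprn_ge0 k0 (ler0n R 2)) k0v.
    by rewrite mulfV// expf_neq0 ?pnatr_eq0.
  have K2 : 2 ^+ k0 * v <= 2.
    have := ler_wpM2l (exprn_ge0 k0 (ler0n R 2)) vk0.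
    by rewrite -{2}(prednK (ltnW k02)) exprS mulrK// unitfE expf_neq0 ?pnatr_eq0.
  move: hK K1 K2 z {vk0 k0v}; move: (2 ^+ k0) ((1 - v) ^+ n) => K y hK K1 K2 z.
  have vK : v <= K * v / 4 by nra.
  apply: (@le_trans _ _ ((6 + 52 / 1000) * ((1 - v) * (3 / 5)))); last first.
    by apply: ler_wpM2l; [lra|apply: ler_wpM2l; lra].
  set Kv := K * v in K1 K2 vK *.
  rewrite (_ : v * _ = 3 / 4 * (6 * Kv - 2 * Kv ^+ 2 - 4 * v)); last first.
    by rewrite /Kv; ring.
  (* [31 / 20] is close to the maximiser of the quadratic in [Kv] that remains after
     [v <= Kv / 4]. *)
  have := sqr_ge0 (Kv - 31 / 20).
  by rewrite !expr2; lra.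
(* In the last case the smallest admissible [M] is taken, so that [1 < M] forces [2 ^ M < n]; the
   constants fit as [5 / 2 < (6 + 52 / 1000) * 11 / 25]. *)
have exM : exists M, (0 < M)%N && (n <= 2 ^ M.+1)%N.
  exists n; rewrite n0 ltnW// (leq_trans (ltn_expl n (ltnSn 1)))// leq_exp2l//; lia.
have [M /andP[M0 nM] Mmin] := ex_minnP exM.
exists M; split => // w w0 wP.
have Mn : (1 < M)%N -> (2 ^ M < n)%N.
  move=> M1; rewrite ltnNge; apply/negP => nM'.
  by have := Mmin M.-1; rewrite prednK// nM' andbT; lia.
apply: le_trans (potential_init_lin v0 M0 Mn w0 wP) _.
have v12 : 0 <= v <= 1 / 2 by lra.
by have := geom_ge_lin v12 (ltW z); have := ler0n R n; lra.
Qed.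

End numeric_bounds.

(** * Runs of the walk *)

Section run.
Variables (n M : nat) (kappa : nat -> nat).
Hypotheses (n_le : (n <= 2 ^ M.+1)%N) (M_gt0 : (0 < M)%N)
  (kappa_gt0 : forall i, (0 < i)%N -> (0 < kappa i)%N).

Fixpoint arun (i : nat) : astate :=
  if i is j.+1 then anext n i (arun j) (kappa i) else Some (0, 1)%N.

Definition adur (i : nat) : nat := aduration n i (arun i.-1) (kappa i).

Lemma arun_valid i : valid M (arun i).
Proof.
elim: i => [|i IH]; first by rewrite /= M_gt0.
by apply: anext_valid => //; exact: kappa_gt0.
Qed.

Let covered s := exists2 j, (0 < j <= s)%N & (s < j + adur j)%N.

(** Invariant: coverage reaches time [i + t + 2 ^ l - 2]. A tick moves one unit from [t] to [i]; an
    expiry keeps the sum because [2 ^ l = 2 ^ l.-1 + 2 ^ l.-1]. *)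
Let covered_upto (i : nat) := forall s, (0 < s <= n)%N ->
  (if arun i is Some (l, t) then (s + 2 <= i + t + 2 ^ l)%N else true) ->
  covered s.

Let covered_uptoP i : (i <= n)%N -> covered_upto i.
Proof.
elim: i => [_|i IH ltin] s /andP[s0 sn]; first by rewrite /=; lia.
have {IH} := IH (ltnW ltin) s; rewrite /covered_upto s0 sn /=.
have := arun_valid i; have := erefl (adur i.+1); rewrite {2}/adur /=.
case: (arun i) => [[l t]|_ _ /(_ isT isT)//].
have k0 := kappa_gt0 (ltn0Sn i); set k := kappa i.+1 in k0 *.
move=> /= durE /and3P[lM t0 tl] /(_ isT) IH.
have l0 : (0 < 2 ^ l)%N by rewrite expn_gt0.
have [lk|kl] := ltnP l k; last first.
  have lgt0 : (0 < l)%N by exact: leq_trans kl.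
  case: ifPn => [/eqP t1|t1] /= h; apply: IH; last by lia.
  by move: h; rewrite -(prednK lgt0) /= expnS; lia.
have [si|si] := leqP s i; first by move=> _; apply: IH; lia.
rewrite lk in durE; case: ifPn durE => h durE /= hs; exists i.+1; rewrite ?durE.
- by [].
- by lia.
- by lia.
- by rewrite expnS; lia.
Qed.

Lemma adur_covers s : (0 < s <= n)%N ->
  exists2 j, (0 < j <= s)%N & (s < j + adur j)%N.
Proof.
move=> sn; apply: (@covered_uptoP n) => //.
have := arun_valid n; case: (arun n) => [[l t]|//] /and3P[_ t0 _].
have l0 : (0 < 2 ^ l)%N by rewrite expn_gt0.
by lia.
Qed.

End run.

(** * Expected counted duration over words of independent symbols *)

Section finite_expectation.
Context {R : realFieldType}.

(** Expectation over [m] independent letters of law [p], written as an iterated sum so that the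
    induction along the walk is free of measure theory. *)
Fixpoint expect (A : finType) (p : A -> R) (m : nat) (g : seq A -> R) : R :=
  if m is m'.+1 then \sum_a p a * expect p m' (fun s => g (a :: s)) else g [::].

Lemma eq_expect (A : finType) (p : A -> R) (m : nat) (g h : seq A -> R) :
  (forall s, g s = h s) -> expect p m g = expect p m h.
Proof.
elim: m g h => //= m IH g h gh.
by apply: eq_bigr => a _; congr (_ * _); exact: IH.
Qed.

Lemma expectD (A : finType) (p : A -> R) (m : nat) (c : R) (g : seq A -> R) :
  \sum_a p a = 1 -> expect p m (fun s => c + g s) = c + expect p m g.
Proof.
move=> p1; elim: m g => //= m IH g.
under eq_bigr do rewrite IH mulrDr.
by rewrite big_split /= -mulr_suml p1 mul1r.
Qed.

(** A letter holds a class and a flag for a cost above [r]; only flagged hires are counted. *)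
Fixpoint atotal (M n i : nat) (s : astate) (l : seq ('I_M.+1 * bool)) : R :=
  if l is a :: l' then
    (aduration n i s a.1 * a.2)%:R + atotal n i.+1 (anext n i s a.1) l'
  else 0.

Lemma atotal_ge0 M n i s l : 0 <= @atotal M n i s l.
Proof. by elim: l i s => //= a l IH i s; rewrite addr_ge0. Qed.

Lemma atotal_arun (M n : nat) (kappa : nat -> nat) (b : nat -> bool) (i m : nat) :
  (forall j, kappa j <= M)%N ->
  @atotal M n i.+1 (arun n kappa i)
    [seq (inord (kappa j), b j) | j <- iota i.+1 m] =
  \sum_(i.+1 <= j < i.+1 + m) (adur n kappa j * b j)%:R.
Proof.
move=> kM; elim: m i => [|m IH] i; first by rewrite addn0 big_geq.
rewrite [LHS]/= inordK ?ltnS// big_ltn; last by lia.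
by congr (_ + _); rewrite addnS -addSn -IH.
Qed.

Section symbols.
Variables (w pk : nat -> R) (M n : nat).
Hypotheses (w_ge0 : forall k, 0 <= w k) (M_gt0 : (0 < M)%N)
  (n_le : (n <= 2 ^ M.+1)%N)
  (pk_low : forall k, (0 < k < M)%N -> pk k = 2 ^- k)
  (pk_0 : pk 0%N = 0) (pk_M : pk M = 2 ^- M.-1).

Definition symbol_weight (a : 'I_M.+1 * bool) : R :=
  if a.2 then w a.1 else pk a.1 - w a.1.

Lemma sum_symbol (F : nat -> bool -> R) :
  \sum_(a : 'I_M.+1 * bool) symbol_weight a * F a.1 a.2 =
  \sum_(0 <= k < M.+1) (w k * F k true + (pk k - w k) * F k false).
Proof.
rewrite -(pair_big xpredT xpredT (fun k b => symbol_weight (k, b) * F k b)) /=.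
rewrite big_mkord; apply: eq_bigr => k _.
by rewrite big_bool.
Qed.

Lemma sum_symbol_weight : \sum_a symbol_weight a = 1.
Proof.
under eq_bigr do rewrite -[symbol_weight _]mulr1.
rewrite (sum_symbol (fun _ _ => 1)) big_nat_recr//=.
under eq_bigr do rewrite !mulr1 addrC subrK.
rewrite !mulr1 [X in _ + X]addrC subrK -{1}(prednK M_gt0).
by rewrite (pk_sum pk_low pk_0) ?prednK// pk_M subrK.
Qed.

(** Iterates [potential_step]. A flag affects only the duration of its own letter, so summing it out
    leaves weight [w] on the duration and [pk] on the future. *)
Lemma expect_atotal_le (m i : nat) (s : astate) : (0 < i)%N -> (i + m)%N = n.+1 ->
  valid M s -> expect symbol_weight m (atotal n i s) <= potential w M n s.
Proof.
elim: m i s => [|m IH] i s i0 im sM; first exact: potential_ge0.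
have i_n : (0 < i <= n)%N by rewrite i0; lia.
apply: le_trans (potential_step w_ge0 M_gt0 n_le pk_low pk_0 i_n sM).
pose E k := expect symbol_weight m (atotal n i.+1 (anext n i s k)).
rewrite [leLHS](_ : _ = \sum_(a : 'I_M.+1 * bool) symbol_weight a *
    ((aduration n i s a.1 * a.2)%:R + E a.1)); last first.
  by apply: eq_bigr => a _; rewrite -expectD ?sum_symbol_weight.
rewrite (sum_symbol (fun k b => (aduration n i s k * b)%:R + E k)).
apply: ler_sum_nat => k /andP[_ kM].
rewrite muln1 muln0 add0r mulrDr mulrBl addrA addrAC addrK lerD//.
(* [anext_valid] asks for a positive class; class 0 drops out by its zero weight. *)
have [->|k0] := posnP k; first by rewrite pk_0 !mul0r.
rewrite ler_wpM2l//.
  move: kM; rewrite ltnS leq_eqVlt => /predU1P[->|kM].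
    by rewrite pk_M invr_ge0 exprn_ge0.
  by rewrite pk_low ?k0// invr_ge0 exprn_ge0.
apply: IH => //; first by lia.
exact: anext_valid.
Qed.

End symbols.
End finite_expectation.

(** * Algorithm 3 as a walk on levels *)

Lemma while_loopE (S : Type) (b : S -> bool) (f : S -> S) (s : S) (j : nat) :
  ~~ b (iter j f s) -> (forall k, (k < j)%N -> b (iter k f s)) ->
  while_loop b f s = iter j f s.
Proof.
move=> bj bk; rewrite /while_loop; congr (iter _ f s).
apply: xget_unique => // k [bk' bkk].
have [kj|jk|//] := ltngtP k j; first by move: bk'; rewrite bk.
by move: bj; rewrite bkk.
Qed.

Section trace.
Context {R : realType}.
Variable delta : R -> \bar R.
Hypothesis delta_mono : forall k l, (k <= l)%N ->
  (delta (2 ^- l) <= delta (2 ^- k))%E.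

Definition below (k : nat) (x : R) : bool := (x%:E <= delta (2 ^- k))%E.

Lemma belowW k l x : (k <= l)%N -> below l x -> below k x.
Proof. by move=> kl xl; exact: le_trans xl (delta_mono kl). Qed.

(** [find] returns [M] when all [M] thresholds pass, which caps the class. *)
Definition cls (M : nat) (x : R) : nat :=
  find (fun k => ~~ below k x) (iota 0 M).

Lemma cls_le M x : (cls M x <= M)%N.
Proof. by rewrite -[leqRHS](size_iota 0) find_size. Qed.

Lemma ltn_cls M x l : (l < M)%N -> (l < cls M x)%N = below l x.
Proof.
move=> lM; apply/idP/idP => [lc|bl].
  by have /negbFE := before_find 0%N lc; rewrite nth_iota.
rewrite ltnNge; apply/negP => cl.
have cM : (cls M x < M)%N by exact: leq_ltn_trans lM.
have := @nth_find _ 0%N (fun k => ~~ below k x) (iota 0 M).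
rewrite has_find size_iota => /(_ cM); rewrite nth_iota// add0n.
by rewrite (belowW cl bl).
Qed.

(** Regular costs: the class is at least 1 and the halving loop terminates. *)
Definition good (x : R) : Prop :=
  [/\ 0 <= x, below 0 x & exists k, ~~ below k x].

Lemma cls_gt0 M x : (0 < M)%N -> good x -> (0 < cls M x)%N.
Proof. by move=> M0 [_ + _]; rewrite -(@ltn_cls M). Qed.

(** [k] is the first threshold that [x] fails. By monotonicity it does not depend on the starting
    level, and [cls] is its cap. *)
Lemma while_halve (x : R) (l : nat) : below l x -> (exists k, ~~ below k x) ->
  exists2 k, while_loop (fun p => (x%:E <= delta p)%E) (fun p => p / 2) (2 ^- l)
    = 2 ^- k & forall M, (l < M)%N -> cls M x = minn k M.
Proof.
move=> bl exk; have [k nbk kmin] := ex_minnP exk.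
have bk j : (j < k)%N -> below j x.
  by move=> jk; apply/negPn/negP => /kmin; rewrite leqNgt jk.
have lk : (l < k)%N.
  by rewrite ltnNge; apply/negP => kl; move: nbk; rewrite (belowW kl bl).
have itE j : iter j (fun p : R => p / 2) (2 ^- l) = 2 ^- (l + j).
  elim: j => [|j IH]; first by rewrite addn0.
  by rewrite iterS IH addnS exprSr invfM mulrC.
exists k => [|M lM].
  have := @while_loopE _ (fun p => (x%:E <= delta p)%E) (fun p => p / 2) (2 ^- l)
    (k - l)%N.
  rewrite itE (subnKC (ltnW lk)); apply=> // j jk.
  by rewrite itE; apply: bk; lia.
have cM := cls_le M x.
have [kM|Mk] := ltnP k M.
  have : (k < cls M x)%N = false by rewrite ltn_cls//; exact: negbTE.
  have : (k.-1 < cls M x)%N by rewrite ltn_cls ?bk//; lia.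
  by lia.
have : (M.-1 < cls M x)%N by rewrite ltn_cls ?bk//; lia.
by lia.
Qed.

Definition simulates (st : @state R) (s : astate) : Prop :=
  if s is Some (l, t) then
    [/\ stopped st = false, q_of st = 2 ^- l & t_of st = t%:R]
  else stopped st = true.

(** The cap is invisible: a hire of true class at least [M] overruns the horizon since
    [n <= 2 ^ M.+1], so program and walk both stop. *)
Lemma step_simulates (n M : nat) (st : state) (s : astate) (x : R) :
  (n <= 2 ^ M.+1)%N -> ((time st).+1 <= n)%N -> good x -> valid M s ->
  simulates st s ->
  [/\ time (step delta n st x) = (time st).+1,
     simulates (step delta n st x) (anext n (time st).+1 s (cls M x)) &
     hired (step delta n st x) = (aduration n (time st).+1 s (cls M x))%:R].
Proof.
move=> nM stn [_ bx0 exk]; case: s => [[l t]|_ /=]; last first.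
  by rewrite /step => ->.
move=> /and3P[lM t0 tl] [/= sst qst tst].
have [T1 T2] : (forall k, 2 / 2 ^- k = (2 ^ k.+1)%:R :> R) /\
    (forall k, 1 / 2 ^- k = (2 ^ k)%:R :> R).
  by split => k; rewrite invrK -?natrX -?natrM ?mul1r// expnS.
rewrite /step sst qst tst -/(below l x) -(@ltn_cls M x l lM).
case: ltnP => [lc|cl]; last first.
  have l0 : (0 < l)%N.
    by rewrite (leq_trans _ cl)// ltn_cls// (leq_ltn_trans _ lM).
  rewrite -[t in t%:R](prednK t0) -natr1 addrK pnatr_eq0.
  have -> : (t.-1 == 0)%N = (t == 1)%N by lia.
  have E : 2 * 2 ^- l = 2 ^- l.-1 :> R.
    rewrite -[in LHS](prednK l0) exprS; field.
    by rewrite expf_neq0 ?pnatr_eq0.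
  by case: ifP => _ /=; split; rewrite // ?E ?T2.
have bl : below l x by rewrite -(@ltn_cls M).
have [k -> /(_ M lM) cE] := while_halve bl exk.
rewrite T1 T2 -natrD ltr_nat.
have -> : (n < (time st).+1 + 2 ^ k.+1)%N = (n < (time st).+1 + 2 ^ (cls M x).+1)%N.
  rewrite cE; have [//|Mk] := leqP k M; rewrite !(leq_ltn_trans nM)//.
    by rewrite -[X in (X < _)%N]add0n ltn_add2r.
  by rewrite -[X in (X < _)%N]add0n -addSn leq_add// leq_exp2l// ltnW.
case: ifPn => [_|nk]; first by split=> //=; rewrite -[RHS]natr1 natrB.
have <- : cls M x = k.
  rewrite cE; apply/minn_idPl; rewrite leqNgt; apply/negP => Mk.
  move: nk; rewrite cE (minn_idPr (ltnW Mk)) (leq_ltn_trans nM)//.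
  by rewrite -[X in (X < _)%N]add0n ltn_add2r.
by split.
Qed.

Section sequence.
Variables (n M : nat) (x : nat -> R).
Hypotheses (M_gt0 : (0 < M)%N) (n_le : (n <= 2 ^ M.+1)%N)
  (x_good : forall i, good (x i.+1)).

Let kappa i := cls M (x i).

Let kappa_gt0 i : (0 < i)%N -> (0 < kappa i)%N.
Proof. by case: i => // i _; exact: cls_gt0. Qed.

Let st i := foldl (step delta n) init [seq x j | j <- iota 1 i].

Let stS i : st i.+1 = step delta n (st i) (x i.+1).
Proof. by rewrite /st -[in LHS](addn1 i) iotaD map_cat foldl_cat. Qed.

Let st_simulates i : (i <= n)%N ->
  time (st i) = i /\ simulates (st i) (arun n kappa i).
Proof.
elim: i => [_|i IH ltin]; first by rewrite /= expr0 invr1.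
have [ti si] := IH (ltnW ltin); rewrite stS.
have [] := @step_simulates n M (st i) (arun n kappa i) (x i.+1) n_le.
- by rewrite ti.
- exact: x_good.
- exact: arun_valid.
- exact: si.
- by rewrite ti => -> /=.
Qed.

Lemma durations_adur i : (0 < i <= n)%N ->
  durations (algorithm3 delta) n x i = (adur n kappa i)%:R.
Proof.
case: i => // i /= ltin; have [ti si] := st_simulates (ltnW ltin).
rewrite /durations /algorithm3 -/(st i.+1) stS.
have [] := @step_simulates n M (st i) (arun n kappa i) (x i.+1) n_le.
- by rewrite ti.
- exact: x_good.
- exact: arun_valid.
- exact: si.
- by rewrite ti => _ _ ->.
Qed.

End sequence.

Lemma algorithm3_feasible (n : nat) (x : nat -> R) :
  (forall i, good (x i.+1)) -> feasible n (durations (algorithm3 delta) n x).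
Proof.
move=> xg; have n_le : (n <= 2 ^ n.+2)%N.
  by rewrite ltnW// (leq_trans (ltn_expl n (ltnSn 1)))// leq_exp2l//; lia.
have durE := @durations_adur n n.+1 x (ltn0Sn n) n_le xg.
split=> [i i_n|s sn]; first by rewrite durE// natr_nat.
have [||j js sj] := @adur_covers n n.+1 (fun i => cls n.+1 (x i)) n_le _ _ s sn.
- by [].
- by case=> // i _; exact: cls_gt0.
exists j => //; rewrite durE; last by lia.
by rewrite -natrD lerBrDr natr1 ler_nat.
Qed.

End trace.

(** * Quantiles and symbol probabilities *)

Section quantile.
Context {R : realType}.
Variables (X : probability R R) (delta : R -> \bar R).
Hypothesis delta_quantile : is_quantile X delta.

Lemma measurable_le_ereal (a : \bar R) : measurable [set r : R | (r%:E <= a)%E].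
Proof.
case: a => [a| |].
- rewrite (_ : [set _ | _] = `]-oo, a]%classic); first exact: measurable_itv.
  by apply/seteqP; split=> r /=; rewrite in_itv /= lee_fin.
- by rewrite (_ : [set _ | _] = setT)//; apply/seteqP; split=> r //= _; rewrite leey.
- rewrite (_ : [set _ | _] = set0)//; apply/seteqP; split=> r //=.
Qed.

Lemma prob_below k : X [set r | below delta k r] = (2 ^- k)%:E.
Proof.
apply: delta_quantile; rewrite half_pow_gt0 /=.
by rewrite -[leRHS](invr1) -(expr0 2) half_pow_le.
Qed.

(** Valid for any choice of quantiles: the opposite order would nest the two sets against their
    distinct masses. *)
Lemma quantile_mono k l : (k <= l)%N -> (delta (2 ^- l) <= delta (2 ^- k))%E.
Proof.
rewrite leq_eqVlt => /predU1P[->//|kl]; rewrite leNgt; apply/negP => dlt.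
have : (X [set r | below delta k r] <= X [set r | below delta l r])%E.
  apply: le_measure; rewrite ?inE; try exact: measurable_le_ereal.
  by move=> r /= /le_trans; apply; exact: ltW.
rewrite !prob_below lee_fin lef_pV2 ?posrE ?exprn_gt0//.
by rewrite ler_eXn2l ?ltr1n// leqNgt kl.
Qed.

Let cls_lt := ltn_cls quantile_mono.

Lemma measurable_below k : measurable [set r | below delta k r].
Proof. exact: measurable_le_ereal. Qed.

Section good.
Hypothesis X_0 : distribution_function X 0 = 0%E.

Lemma measurable_good : measurable [set r | good delta r].
Proof.
rewrite (_ : [set r | _] = [set r | 0 <= r] `&` [set r | below delta 0 r] `&`
    \bigcup_k ~` [set r | below delta k r]).
  apply: measurableI.
    apply: measurableI; last exact: measurable_below.
    rewrite (_ : [set _ | _] = `[0, +oo[%classic); first exact: measurable_itv.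
    by apply/seteqP; split=> r /=; rewrite in_itv /= andbT.
  by apply: bigcup_measurable => k _; apply: measurableC; exact: measurable_below.
apply/seteqP; split=> r.
  by move=> [r0 br [k nk]]; split=> //; exists k => //; exact/negP.
by move=> [[r0 br] [k _ /negP nk]]; split=> //; exists k.
Qed.

(** For every [k] the bad costs lie in the union of [x <= 0], a failure of threshold 0, and success
    at threshold [k]. The first two are null and the third has mass [2 ^- k]. *)
Lemma prob_not_good : X (~` [set r | good delta r]) = 0%E.
Proof.
apply/eqP; rewrite eq_le measure_ge0 andbT; apply/lee_addgt0Pr => e e0.
pose k := (Num.truncn e^-1).+1.
have ke : 2 ^- k <= e.
  rewrite -[leRHS]invrK lef_pV2 ?posrE ?exprn_gt0 ?invr_gt0//.
  rewrite (le_trans (ltW (truncnS_gt _)))// -/k -natrX ler_nat.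
  by rewrite ltnW// ltn_expl.
have sub : ~` [set r | good delta r] `<=`
    `]-oo, 0%R]%classic `|` (~` [set r | below delta 0 r] `|` [set r | below delta k r]).
  move=> r /= ngood; rewrite in_itv /=.
  have [r0|r0] := leP r 0; first by left.
  right; have [b0|b0] := boolP (below delta 0 r); last by left; exact/negP.
  right; have [//|bk] := boolP (below delta k r).
  by exfalso; apply: ngood; split=> //; [exact: ltW|exists k].
have mb := measurable_below; have mi : measurable (`]-oo, 0%R]%classic : set R).
  exact: measurable_itv.
have mCb : measurable (~` [set r | below delta 0 r]) by exact: measurableC.
apply: le_trans (le_measure _ _ _ sub) _; rewrite ?inE.
- by apply: measurableC; exact: measurable_good.
- by apply: measurableU => //; exact: measurableU.
have mU := measurableU _ _ mCb (mb k).
set I := `]-oo, 0%R]%classic in mi *.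
set U := ~` _ in mCb mU *; set V := [set r | below delta k r] in mU *.
have U1 : (X (I `|` (U `|` V)) <= X I + X (U `|` V))%E by exact: (measureU2 _ mi mU).
have U2 : (X (U `|` V) <= X U + X V)%E by exact: (measureU2 _ mCb (mb k)).
apply: le_trans U1 _; rewrite [X I]X_0 add0e (le_trans U2)//.
by rewrite probability_setC// !prob_below expr0 invr1 subee// !add0e lee_fin.
Qed.

End good.

(** * Joint law of the class and the flag of one applicant *)

Section symbol.
Variables (M : nat) (r : R).
Hypothesis M_gt0 : (0 < M)%N.

Definition cdf : R := fine (X `]-oo, r]%classic).

Lemma cdfE : X `]-oo, r]%classic = cdf%:E.
Proof. by rewrite fineK// fin_num_measure. Qed.

Lemma cdf_itv : 0 <= cdf <= 1.
Proof. by rewrite -!lee_fin -cdfE measure_ge0 probability_le1. Qed.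

Definition symbol (x : R) : 'I_M.+1 * bool := (inord (cls delta M x), r < x).

Let above l : set R := [set x | (l < cls delta M x)%N].
Let above_or l : set R := above l `|` `]-oo, r]%classic.

Let aboveE l : (l < M)%N -> above l = [set x | below delta l x].
Proof. by move=> lM; apply/seteqP; split=> x; rewrite /above /= cls_lt. Qed.

Let above0 l : (M <= l)%N -> above l = set0.
Proof.
move=> Ml; apply/seteqP; split=> x //; rewrite /above /=.
by rewrite ltnNge (leq_trans (cls_le _ _ _)).
Qed.

Let measurable_above l : measurable (above l).
Proof.
have [lM|Ml] := ltnP l M; last by rewrite above0.
by rewrite aboveE//; exact: measurable_below.
Qed.

Let measurable_above_or l : measurable (above_or l).
Proof. by apply: measurableU => //; exact: measurable_itv. Qed.

Let above_sub l : above l.+1 `<=` above l.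
Proof. by move=> x; exact: ltn_trans. Qed.

Let prob_above l : X (above l) = (if (l < M)%N then 2 ^- l else 0)%:E.
Proof.
by case: ltnP => lM; [rewrite aboveE// prob_below|rewrite above0// measure0].
Qed.

(** Both sets in the union are closed under decreasing the cost, so one contains the other and the
    larger mass remains. *)
Let prob_above_or l :
  X (above_or l) = (if (l < M)%N then Num.max (2 ^- l) cdf else cdf)%:E.
Proof.
case: ltnP => lM; last by rewrite /above_or above0// set0U cdfE.
rewrite /above_or aboveE//; have mi : measurable (`]-oo, r]%classic : set R).
  exact: measurable_itv.
have [rd|dr] := leP r%:E (delta (2 ^- l)).
  have sub : `]-oo, r]%classic `<=` [set x | below delta l x].
    by move=> x /=; rewrite in_itv /= -lee_fin => /le_trans; exact.
  rewrite (setUidl sub) prob_below; congr (_%:E).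
  apply/esym/max_idPl; rewrite -lee_fin -cdfE -prob_below.
  by apply: le_measure => //; rewrite inE//; exact: measurable_below.
have sub : [set x | below delta l x] `<=` `]-oo, r]%classic.
  by move=> x /= xl; rewrite in_itv /= -lee_fin (le_trans xl)// ltW.
rewrite (setUidr sub) cdfE; congr (_%:E).
apply/esym/max_idPr; rewrite -lee_fin -cdfE -prob_below.
by apply: le_measure => //; rewrite inE//; exact: measurable_below.
Qed.

Definition flag_prob (k : nat) : R :=
  if k is k'.+1 then fine (X (above_or k')) - fine (X (above_or k)) else 0.

Definition class_prob (k : nat) : R :=
  if k is k'.+1 then fine (X (above k')) - fine (X (above k)) else 0.

Lemma flag_prob_weight : is_class_weight cdf M flag_prob.
Proof.
split=> [[//|k] /andP[_ kM]|].
  by rewrite /flag_prob !prob_above_or kM (ltn_trans _ kM).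
by rewrite -[in LHS](prednK M_gt0) /flag_prob !prob_above_or prednK// leqnn ltnn.
Qed.

Lemma class_prob_low k : (0 < k < M)%N -> class_prob k = 2 ^- k.
Proof.
case: k => // k /andP[_ kM]; rewrite /class_prob !prob_above kM (ltn_trans _ kM)//=.
by rewrite exprS; field; rewrite expf_neq0 ?pnatr_eq0.
Qed.

Lemma class_prob_top : class_prob M = 2 ^- M.-1.
Proof.
rewrite -[in LHS](prednK M_gt0) /class_prob !prob_above prednK// leqnn ltnn /=.
by rewrite subr0.
Qed.

Let fin_diff (U V : set R) : measurable U -> measurable V -> V `<=` U ->
  X (U `\` V) = (fine (X U) - fine (X V))%:E.
Proof.
move=> mU mV VU; rewrite measureD// ?setIidr// ?EFinB ?fineK ?fin_num_measure//.
by rewrite ltey_eq fin_num_measure.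
Qed.

Let above_or_sub l : above_or l.+1 `<=` above_or l.
Proof. exact: setSU. Qed.

Lemma flag_prob_ge0 k : 0 <= flag_prob k.
Proof.
case: k => // k; rewrite -lee_fin -fin_diff//; exact: measure_ge0.
Qed.

Let clsE k : [set x | cls delta M x = k.+1] = above k `\` above k.+1.
Proof.
apply/seteqP; split=> x; rewrite /above /=.
  by move=> ->; rewrite ltnS leqnn ltnn.
by move=> [kx /negP]; lia.
Qed.

Let prob_cls0 (U : set R) : U `<=` ~` above 0 -> measurable U -> X U = 0%E.
Proof.
move=> sub mU; apply/eqP; rewrite eq_le measure_ge0 andbT.
have le : (X U <= X (~` above 0))%E.
  by apply: le_measure => //; rewrite inE//; exact: measurableC.
by rewrite (le_trans le)// probability_setC// prob_above M_gt0 expr0 invr1 subee.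
Qed.

Let symbol_set (a : 'I_M.+1 * bool) :
  [set x | symbol x = a] =
  [set x | cls delta M x = a.1] `&`
    (if a.2 then ~` `]-oo, r]%classic else `]-oo, r]%classic).
Proof.
case: a => k b; apply/seteqP; split=> x /=; rewrite /symbol.
  move=> [<- <-]; rewrite inordK ?ltnS ?cls_le//; split=> //.
  by case: ltP => rx /=; rewrite in_itv /= -?ltNge//; apply/negP; rewrite -ltNge.
move=> [ck xb]; congr pair; first by apply/val_inj; rewrite /= inordK ?ltnS ?cls_le.
case: b xb => /=; rewrite in_itv /=; first by move/negP; rewrite -ltNge.
by rewrite leNgt => /negbTE.
Qed.

Let measurable_cls k : measurable [set x | cls delta M x = k].
Proof.
case: k => [|k]; last by rewrite clsE; exact: measurableD.
rewrite (_ : [set _ | _] = ~` above 0); first exact: measurableC.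
by apply/seteqP; split=> x; rewrite /above /=; case: (cls _ _ _) => //= ? /(_ isT).
Qed.

Lemma measurable_symbol a : measurable [set x | symbol x = a].
Proof.
rewrite symbol_set; apply: measurableI; first exact: measurable_cls.
by case: a.2; [apply: measurableC|]; exact: measurable_itv.
Qed.

(** The flagged part of a class is a difference of two nested [above_or] sets; the unflagged part is
    what remains of the class. *)
Lemma prob_symbol a :
  X [set x | symbol x = a] = (symbol_weight flag_prob class_prob a)%:E.
Proof.
have mi : measurable (`]-oo, r]%classic : set R) by exact: measurable_itv.
case: a => k b; have := measurable_symbol (k, b).
rewrite symbol_set /symbol_weight /=.
case: (val k) => {k} [|k] mU.
  rewrite subrr if_same prob_cls0// => x [/= cx _].
  by rewrite /above /= cx.
have T_flag : X ([set x | cls delta M x = k.+1] `&` ~` `]-oo, r]%classic) =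
    (flag_prob k.+1)%:E.
  rewrite -fin_diff//; congr (X _); rewrite clsE.
  apply/seteqP; split=> x; rewrite /above_or.
    by move=> [[xk nxk] nr]; split; first (by left); case.
  move=> [[xk|xr] nx]; last by exfalso; apply: nx; right.
  by split; [split=> // ?|move=> ?]; apply: nx; [left|right].
case: b mU => // mU; have mC := measurable_cls k.+1.
have CE : X [set x | cls delta M x = k.+1] = (class_prob k.+1)%:E.
  by rewrite clsE fin_diff.
have DI : X [set x | cls delta M x = k.+1] =
    (X ([set x | cls delta M x = k.+1] `&` ~` `]-oo, r]%classic) +
     X ([set x | cls delta M x = k.+1] `&` `]-oo, r]%classic))%E.
  by rewrite -setDE; exact: (measureDI _ mC mi).
by rewrite EFinB -CE DI T_flag [X in (X - _)%E]addeC addeK.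
Qed.

End symbol.
End quantile.

(** * Expectations over i.i.d. symbols *)

Section iid_sequence.
Context d (T : measurableType d) (R : realType) (P : probability T R).
Variables (X : probability R R) (x : nat -> {RV P >-> R}).
Hypothesis x_iid : iid X x.

Lemma prob_preimage i (B : set R) : (0 < i)%N -> measurable B ->
  P (x i @^-1` B) = X B.
Proof. by move=> i0 mB; exact: x_iid.1. Qed.

Lemma measurable_preimage i (B : set R) : measurable B -> measurable (x i @^-1` B).
Proof. by move=> mB; rewrite -[_ @^-1` _]setTI; exact: measurable_funP. Qed.

Lemma ae_all (G : set R) : measurable G -> X (~` G) = 0%E ->
  {ae P, forall w, forall i, G (x i.+1 w)}.
Proof.
move=> mG XG; apply: ae_foralln => i.
have mCG := measurableC mG.
exists (x i.+1 @^-1` (~` G)); split=> //; first exact: measurable_preimage.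
exact: etrans (prob_preimage (ltn0Sn i) mCG) XG.
Qed.

Section finite_symbols.
Variables (A : finType) (f : R -> A) (p : A -> R).
Hypotheses (measurable_f : forall a, measurable [set y | f y = a])
  (prob_f : forall a, X [set y | f y = a] = (p a)%:E).

Definition symbols (m : nat) (w : T) : seq A := [seq f (x j w) | j <- iota 1 m].

Definition cylinder (l : seq A) : set T := [set w | symbols (size l) w = l].

Let size_symbols m w : size (symbols m w) = m.
Proof. by rewrite size_map size_iota. Qed.

Let letter (l : seq A) i : set R := [set y | f y = nth (f 0) l i.-1].

Let cylinderE l : cylinder l =
  \bigcap_(i in [set i | (1 <= i <= size l)%N]) (x i @^-1` letter l i).
Proof.
apply/seteqP; split=> w.
  move=> wl i /= /andP[i0 il]; rewrite /letter /= -wl.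
  rewrite (nth_map 0%N) ?size_iota ?nth_iota ?prednK//.
  by rewrite add1n prednK.
move=> wl; apply: (@eq_from_nth _ (f 0)); rewrite size_symbols// => i il.
rewrite (nth_map 0%N) ?size_iota ?nth_iota//.
by have := wl i.+1; rewrite /letter /= il add1n; exact.
Qed.

Lemma measurable_cylinder l : measurable (cylinder l).
Proof.
rewrite cylinderE; apply: fin_bigcap_measurable.
  by apply: (@sub_finite_set _ _ `I_(size l).+1); [move=> i /= /andP[]|exact: finite_II].
by move=> i _; apply: measurable_preimage; exact: measurable_f.
Qed.

Lemma prob_cylinder l : P (cylinder l) = (\prod_(a <- l) p a)%:E.
Proof.
rewrite cylinderE x_iid.2; last by move=> i; exact: measurable_f.
rewrite -prodEFin (big_nth (f 0)) big_add1 /=.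
apply: eq_big_nat => i /andP[_ il].
by rewrite prob_preimage//; [exact: prob_f|exact: measurable_f].
Qed.

Let cylinder_rcons l : cylinder l = \big[setU/set0]_(a : A) cylinder (rcons l a).
Proof.
have rc w a : symbols (size l).+1 w = rcons l a <->
    symbols (size l) w = l /\ f (x (size l).+1 w) = a.
  have iotaS : iota 1 (size l).+1 = rcons (iota 1 (size l)) (size l).+1.
    by rewrite -[in LHS](addn1 (size l)) iotaD /= add1n cats1.
  rewrite /symbols iotaS map_rcons.
  by split=> [/rcons_inj[]|[-> ->]].
rewrite -bigcup_seq; apply/seteqP; split=> w.
  move=> wl; exists (f (x (size l).+1 w)) => /=; first by rewrite mem_index_enum.
  by rewrite /cylinder /= size_rcons; apply/rc.
by move=> [a _]; rewrite /cylinder /= size_rcons => /rc[].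
Qed.

Variable g : seq A -> R.
Hypothesis g_ge0 : forall l, 0 <= g l.

Lemma measurable_fun_symbols m (D : set T) :
  measurable_fun D (fun w => (g (symbols m w))%:E).
Proof.
move=> mD Y mY; apply: measurableI => //.
rewrite (_ : _ @^-1` Y =
  \bigcup_(l in [set l : m.-tuple A | Y (g l)%:E]) cylinder l).
  by apply: fin_bigcup_measurable => // l _; exact: measurable_cylinder.
apply/seteqP; split=> w /=.
  move=> Yw; have sz : size (symbols m w) == m by rewrite size_symbols.
  by exists (Tuple sz) => //=; rewrite /cylinder /= size_symbols.
by move=> [l Yl]; rewrite /cylinder /= size_tuple => ->.
Qed.

(** Induction on the number [m] of letters still free: the cylinder splits according to its next
    letter, matching one summation in [expect]. *)
Lemma integral_cylinder m l :
  (\int[P]_(w in cylinder l) (g (symbols (size l + m) w))%:E)%E =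
  ((\prod_(a <- l) p a) * expect p m (fun s => g (l ++ s)))%:E.
Proof.
elim: m l => [|m IH] l.
  rewrite (eq_integral (cst (g l)%:E)); last first.
    by move=> w; rewrite inE => wl; rewrite addn0 wl.
  rewrite integral_cst; last exact: measurable_cylinder.
  by rewrite [X in (_ * X)%E]prob_cylinder /= cats0 -EFinM mulrC.
rewrite {1}cylinder_rcons ge0_integral_bigsetU//=; first last.
- by move=> w _; rewrite lee_fin.
- exact: measurable_fun_symbols.
- move=> a b _ _ [w []]; rewrite /cylinder /= !size_rcons => -> /rcons_inj[].
  by [].
- exact: index_enum_uniq.
- by move=> a; exact: measurable_cylinder.
rewrite mulr_sumr -sumEFin; apply: eq_bigr => a _.
rewrite -addSnnS -(size_rcons l a) IH big_rcons /= -mulrA; congr (_ * (_ * _))%:E.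
by apply: eq_expect => s; rewrite cat_rcons.
Qed.

Lemma integral_symbols m :
  (\int[P]_w (g (symbols m w))%:E)%E = (expect p m g)%:E.
Proof.
have := integral_cylinder m [::]; rewrite big_nil mul1r /= add0n.
by rewrite (_ : cylinder [::] = setT)//; apply/seteqP; split.
Qed.

End finite_symbols.

Definition survive (r : R) (s : nat) : set T :=
  \bigcap_(i in [set i | (1 <= i <= s)%N]) (x i @^-1` `]r, +oo[%classic).

Lemma measurable_survive r s : measurable (survive r s).
Proof.
apply: fin_bigcap_measurable.
  by apply: (@sub_finite_set _ _ `I_s.+1); [move=> i /= /andP[]|exact: finite_II].
by move=> i _; apply: measurable_preimage; exact: measurable_itv.
Qed.

Lemma prob_survive r s : P (survive r s) = ((1 - cdf X r) ^+ s)%:E.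
Proof.
rewrite (x_iid.2 s (fun=> `]r, +oo[%classic)); last first.
  by move=> _; exact: measurable_itv.
have -> : (1 - cdf X r) ^+ s = \prod_(1 <= i < s.+1) (1 - cdf X r).
  by rewrite prodr_const_nat subn1.
rewrite -prodEFin; apply: eq_big_nat => i /andP[i0 _].
rewrite prob_preimage//.
rewrite -setCitvl probability_setC; last exact: measurable_itv.
by rewrite cdfE.
Qed.

(** At each of these time steps any feasible solution holds a contract of cost above [r], since no
    cheaper applicant has arrived. *)
Definition layer_opt (r : R) (n : nat) (w : T) : R :=
  \sum_(1 <= s < n.+1) \1_(survive r s) w.

Lemma measurable_layer_opt r n : measurable_fun setT (fun w => (layer_opt r n w)%:E).
Proof.
under eq_fun do rewrite /layer_opt -sumEFin.
apply: emeasurable_sum => s; apply/measurable_EFinP.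
exact/measurable_indic/measurable_survive.
Qed.

Lemma integral_layer_opt r n : (\int[P]_w (layer_opt r n w)%:E)%E = (geom (cdf X r) n)%:E.
Proof.
under eq_integral do rewrite /layer_opt -sumEFin.
rewrite ge0_integral_sum//; last first.
  move=> s; apply/measurable_EFinP.
  exact/measurable_indic/measurable_survive.
rewrite /geom -sumEFin; apply: eq_bigr => s _.
rewrite integral_indic//; last exact: measurable_survive.
by rewrite setIT; exact: prob_survive.
Qed.

End iid_sequence.

(** * Integrals and layers *)

(* No measurability of [alg] and [opt] is available, so the comparisons go through
   the definition of the integral as a supremum over simple functions. *)
Section nonmeasurable_integral.
Local Open Scope ereal_scope.
Context d (T : measurableType d) (R : realType) (mu : {measure set T -> \bar R}).
Implicit Types f g : T -> \bar R.

(** Every simple function below the positive part of [f] is also below [g], so the suprema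
    compare. *)
Lemma integral_le_ge0 f g : (forall w, 0 <= g w) -> (forall w, f w <= g w) ->
  \int[mu]_w f w <= \int[mu]_w g w.
Proof.
move=> g0 fg; rewrite integralE.
apply: (@le_trans _ _ (\int[mu]_w f^\+ w)).
  by rewrite geeDl// oppe_le0 integral_ge0.
rewrite !ge0_integralTE//; apply: le_ereal_sup => _ [h hf <-]; exists h => //.
move=> w; apply: le_trans (hf w) _.
by rewrite funeposE ge_max fg g0.
Qed.

Lemma integral_le_ae f g : measurable_fun setT g -> (forall w, 0 <= g w) ->
  {ae mu, forall w, f w <= g w} -> \int[mu]_w f w <= \int[mu]_w g w.
Proof.
move=> mg g0 [N [mN muN fgN]].
(* Raising [g] to [+oo] on the null set makes the inequality hold everywhere without changing the
   integral. *)
apply: (@le_trans _ _ (\int[mu]_w (if w \in N then +oo else g w))).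
  apply: integral_le_ge0 => w; first by case: ifP.
  case: ifPn => [_|]; first by rewrite leey.
  by rewrite notin_setE => Nw; apply: contrapT => fg; apply: Nw; exact: fgN.
have mh : measurable_fun setT (fun w => if w \in N then +oo else g w).
  apply: measurable_fun_ifT => //.
  apply: (measurable_fun_bool true).
  by rewrite setTI preimage_mem_true.
rewrite (ge0_negligible_integral mN _ mh _ muN)//; last by move=> w _; case: ifP.
rewrite [leRHS](ge0_negligible_integral mN _ mg _ muN)//.
rewrite (eq_integral g)// => w; rewrite inE => -[_ /= Nw].
by rewrite ifF//; apply/negbTE; rewrite notin_setE.
Qed.

Lemma le_integral_ae f g : measurable_fun setT f -> (forall w, 0 <= f w) ->
  {ae mu, forall w, f w <= g w} -> \int[mu]_w f w <= \int[mu]_w g w.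
Proof.
move=> mf f0 fg; rewrite [leRHS]integralE.
(* The negative part of [g] vanishes almost everywhere; the previous lemma bounds its integral by
   0. *)
have -> : \int[mu]_w g^\- w = 0.
  apply/eqP; rewrite eq_le integral_ge0// andbT.
  rewrite -[leRHS](@integral0 _ _ _ mu setT); apply: integral_le_ae => //.
  move: fg => [N [mN muN fgN]]; exists N; split => // w /= ngw; apply: fgN => fgw.
  by apply: ngw; rewrite funenegE ge_max lexx andbT oppe_le0 (le_trans _ fgw).
rewrite sube0; move: fg => [N [mN muN fgN]].
rewrite (ge0_negligible_integral mN _ mf _ muN)// integral_mkcond.
apply: integral_le_ge0 => w //.
rewrite patchE; case: ifPn => [|_]; last exact: funepos_ge0.
rewrite inE => -[_ /= Nw].
rewrite funeposE le_max; apply/orP; left.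
by apply: contrapT => fg; apply: Nw; exact: fgN.
Qed.

End nonmeasurable_integral.

Section layers.
Context {R : realType}.
Implicit Types (y e : R) (N : nat).

Lemma layer_sum_le y e N : 0 <= y -> 0 < e ->
  \sum_(0 <= j < N) e * (j.+1%:R * e < y)%R%:R <= y.
Proof.
(* The minimum with [N * e] lets a newly counted layer raise the bound by [e]. *)
move=> y0 e0; suff : \sum_(0 <= j < N) e * (j.+1%:R * e < y)%R%:R <=
    Num.min (N%:R * e) y by rewrite le_min => /andP[].
elim: N => [|N IH]; first by rewrite big_geq// mul0r le_min lexx y0.
rewrite big_nat_recr//=; move: IH; rewrite !le_min => /andP[h1 h2].
by case: ltP => h; rewrite -natr1 mulrDl mul1r ?mulr1 ?mulr0 in h *; lra.
Qed.

Lemma layer_sum_ge y e N : 0 < e -> y <= N.+1%:R * e ->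
  y <= e + \sum_(0 <= j < N) e * (j.+1%:R * e < y)%R%:R.
Proof.
move=> e0; suff : Num.min (N.+1%:R * e) y <=
    e + \sum_(0 <= j < N) e * (j.+1%:R * e < y)%R%:R.
  by move=> h yN; rewrite (le_trans _ h)// le_min lexx yN.
elim: N => [|N IH]; first by rewrite big_geq// addr0 mul1r ge_min lexx.
rewrite big_nat_recr//= addrA; move: IH; rewrite !ge_min.
case: ltP => h; rewrite ?mulr1 ?mulr0 ?addr0 => /orP[h1|h1]; apply/orP.
- by left; rewrite -[N.+2%:R]natr1 mulrDl mul1r lerD.
- by right; lra.
- by right; lra.
- by right; lra.
Qed.

Lemma sum_interval_le (n i tau : nat) :
  (\sum_(1 <= s < n.+1) (i <= s < i + tau) <= tau)%N.
Proof.
rewrite -big_mkcond /= sum1_count -size_filter -[leqRHS](size_iota i).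
apply: uniq_leq_size; first by rewrite filter_uniq// iota_uniq.
by move=> s; rewrite mem_filter mem_iota => /andP[].
Qed.

(** Each time step [s] is charged to an applicant covering it, whose cost dominates the layers at
    [s]. After exchanging sums, applicant [i] is charged at most [t i] times. *)
Lemma layer_opt_le_cost (n : nat) (x t : nat -> R) (e : R) (N : nat) :
  0 < e -> (forall i, 0 <= x i.+1) -> feasible n t ->
  \sum_(0 <= j < N) e * \sum_(1 <= s < n.+1)
     `[< forall i, (1 <= i <= s)%N -> j.+1%:R * e < x i >]%R%:R <= cost n x t.
Proof.
move=> e0 x0 [tnat tcov].
have xge0 i : (0 < i)%N -> 0 <= x i by case: i.
apply: (@le_trans _ _ (\sum_(1 <= s < n.+1) \sum_(1 <= i < n.+1)
    ((i <= s < i + Num.truncn (t i))%N)%:R * x i)).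
  under eq_bigr do rewrite mulr_sumr.
  rewrite exchange_big /=; apply: ler_sum_nat => s sn.
  have [i i_s si] := tcov s sn.
  apply: (@le_trans _ _ (x i)).
    apply: le_trans (@layer_sum_le (x i) e N _ e0); last by apply: xge0; lia.
    apply: ler_sum => j _; rewrite ler_wpM2l ?(ltW e0)// ler_nat.
    by case: asboolP => // /(_ i i_s) ->.
  rewrite (bigD1_seq i) ?iota_uniq//=; last by rewrite mem_iota; lia.
  have -> : (i <= s < i + Num.truncn (t i))%N.
    have /natrP[m tm] : t i \is a Num.nat by apply: tnat; lia.
    move: si; rewrite tm natrK -natrD lerBrDr natr1 ler_nat.
    by lia.
  rewrite mul1r lerDl big_seq_cond sumr_ge0// => k; rewrite mem_iota => /andP[k0 _].
  by rewrite mulr_ge0// xge0//; lia.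
rewrite exchange_big /cost; apply: ler_sum_nat => i /andP[i0 i_n].
rewrite -mulr_suml ler_wpM2r ?xge0// -natr_sum.
have /natrP[m tm] : t i \is a Num.nat by apply: tnat; rewrite i0.
by rewrite tm natrK ler_nat; exact: sum_interval_le.
Qed.

End layers.

(** * Competitiveness *)

Section competitiveness.
Context d (T : measurableType d) (R : realType) (P : probability T R).
Variables (X : probability R R) (x : nat -> {RV P >-> R}) (delta : R -> \bar R).
Hypotheses (X_0 : distribution_function X 0 = 0%E) (x_iid : iid X x)
  (delta_quantile : is_quantile X delta).

Let all_good (w : T) := forall i, good delta (x i.+1 w).

Lemma ae_good : {ae P, forall w, all_good w}.
Proof.
have mG := measurable_good delta.
exact: (ae_all x_iid mG (prob_not_good delta_quantile X_0)).
Qed.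

Let ratio : R := 6 + 52 / 1000.

(** [h] depends on finitely many symbols and is therefore measurable everywhere; it agrees with the
    duration of cost above [r] on good outcomes only. *)
Lemma layer_alg (n : nat) (r : R) : (0 < n)%N -> exists h : T -> R,
  [/\ measurable_fun setT (EFin \o h), forall w, 0 <= h w,
    forall w, all_good w -> h w = \sum_(1 <= i < n.+1)
      durations (algorithm3 delta) n (fun i => x i w) i * (r < x i w)%R%:R &
    (\int[P]_w (h w)%:E <= (ratio * geom (cdf X r) n)%:E)%E].
Proof.
move=> n0; have [M [M0 nM bound]] := competitive_bound (cdf_itv X r) n0.
have msym (a : 'I_M.+1 * bool) := measurable_symbol delta_quantile r M0 a.
have psym (a : 'I_M.+1 * bool) := prob_symbol delta_quantile r M0 a.
pose g := @atotal R M n 1 (Some (0, 1)%N).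
exists (fun w => g (symbols x (symbol delta M r) n w)); split.
- exact: measurable_fun_symbols.
- by move=> w; exact: atotal_ge0.
- move=> w wgood; rewrite /g.
  rewrite (@atotal_arun _ _ _ (fun i => cls delta M (x i w)) (fun i => r < x i w) 0).
    rewrite add1n; apply: eq_big_nat => i i_n; rewrite natrM; congr (_ * _).
    by rewrite (durations_adur (quantile_mono delta_quantile) M0 nM wgood).
  by move=> j; exact: cls_le.
rewrite (integral_symbols x_iid msym psym); last by move=> l; exact: atotal_ge0.
rewrite lee_fin; apply: le_trans (bound _ _ (flag_prob_weight delta_quantile r M0)).
  apply: expect_atotal_le => //.
  - by move=> k; exact: flag_prob_ge0.
  - exact: class_prob_low.
  - exact: class_prob_top.
  - by rewrite /= M0.
by move=> k; exact: flag_prob_ge0.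
Qed.

Let thr (e : R) (j : nat) : R := j.+1%:R * e.

Lemma layer_opt_le_opt (n : nat) (e : R) (w : T) : 0 < e -> all_good w ->
  (\sum_(j <oo) (e * layer_opt x (thr e j) n w)%:E <=
   (opt n (fun i => x i w))%:E)%E.
Proof.
move=> e0 wgood.
have lo0 r : 0 <= layer_opt x r n w by apply: sumr_ge0.
apply: lime_le.
  by apply: is_cvg_nneseries => j _ _; rewrite lee_fin mulr_ge0// ltW.
apply: nearW => N; rewrite sumEFin lee_fin; apply: lb_le_inf.
  (* The infimum ranges over a nonempty set: the run of the algorithm is feasible. *)
  have :=
    @algorithm3_feasible _ _ (quantile_mono delta_quantile) n (fun i => x i w) wgood.
  by set t := durations _ _ _ => tf; exists (cost n (fun i => x i w) t), t.
move=> _ [t tf <-].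
have x0 i : 0 <= x i.+1 w by have [] := wgood i.
apply: le_trans (@layer_opt_le_cost _ _ _ _ _ N e0 x0 tf).
rewrite le_eqVlt; apply/orP; left; apply/eqP.
apply: eq_bigr => j _; congr (_ * _); apply: eq_bigr => s _.
rewrite indicE; congr (_%:R); congr nat_of_bool.
apply/idP/asboolP; rewrite inE => h i i_s; have := h i i_s; rewrite /= in_itv /= andbT;
  exact.
Qed.

(** Every cost exceeds [-1], so [h (-1)] is the total duration; [e] times it absorbs the rounding of
    each cost to the mesh. *)
Lemma alg_le_layers (n : nat) (e : R) (h : R -> T -> R) (w : T) : 0 < e ->
  (forall r w, 0 <= h r w) ->
  (forall r, h r w = \sum_(1 <= i < n.+1)
      durations (algorithm3 delta) n (fun i => x i w) i * (r < x i w)%R%:R) ->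
  all_good w ->
  ((alg (algorithm3 delta) n (fun i => x i w))%:E <=
   (e * h (-1) w)%:E + \sum_(j <oo) (e * h (thr e j) w)%:E)%E.
Proof.
move=> e0 h0 hE wgood.
have x0 i : (0 < i)%N -> 0 <= x i w.
  by case: i => // i _; have [] := wgood i.
pose B := \sum_(1 <= i < n.+1) x i w.
have B0 : 0 <= B.
  by rewrite /B big_nat sumr_ge0// => i /andP[i0 _]; exact: x0.
pose N := (Num.truncn (B / e)).+1.
have xN i : (0 < i < n.+1)%N -> x i w <= N.+1%:R * e.
  move=> i_n; apply: (@le_trans _ _ B).
    rewrite /B (bigD1_seq i) ?iota_uniq//=; last by rewrite mem_iota; lia.
    rewrite lerDl big_seq_cond sumr_ge0// => k; rewrite mem_iota => /andP[k0 _].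
    by apply: x0; lia.
  rewrite -ler_pdivrMr//; apply: le_trans (ltW (truncnS_gt _)) _.
  by rewrite ler_nat.
have [tnat _] :=
    @algorithm3_feasible _ _ (quantile_mono delta_quantile) n (fun i => x i w) wgood.
apply: (@le_trans _ _ (e * h (-1) w + \sum_(0 <= j < N) e * h (thr e j) w)%:E).
  rewrite lee_fin /alg /cost.
  rewrite hE; under [X in _ + X]eq_bigr do rewrite hE mulr_sumr.
  rewrite mulr_sumr exchange_big /= -big_split /=; apply: ler_sum_nat => i i_n.
  set t := durations _ _ _ i.
  have t0 : 0 <= t by rewrite natr_ge0// tnat; lia.
  have -> : -1 < x i w.
    by have /x0 xi0 : (0 < i)%N; [lia|rewrite (lt_le_trans _ xi0)// ltrN10].
  rewrite mulr1 -[X in _ + X](_ : t * \sum_(0 <= j < N) e * (thr e j < x i w)%R%:R = _).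
    rewrite [e * t]mulrC -mulrDr ler_wpM2l//.
    by apply: layer_sum_ge => //; exact: xN.
  by rewrite mulr_sumr; apply: eq_bigr => j _; rewrite mulrCA.
rewrite EFinD leeD// -sumEFin; apply: nneseries_lim_ge => j _ _.
by rewrite lee_fin mulr_ge0// ltW.
Qed.

(** Layers are compared one by one through [geom]. The rounding term costs at most [ratio * n * e],
    because [geom] never exceeds [n]. *)
Lemma expectation_bound (n : nat) (e : R) : (0 < n)%N -> 0 < e ->
  ('E_P[fun w => alg (algorithm3 delta) n (fun i => x i w)] <=
   ratio%:E * 'E_P[fun w => opt n (fun i => x i w)] + (ratio * n%:R * e)%:E)%E.
Proof.
move=> n0 e0; have := fun r => layer_alg r n0; move=> /choice[h hP].
have ratio0 : 0 <= ratio by rewrite /ratio; lra.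
have h0 r w : 0 <= h r w by have [_ ->] := hP r.
have mh r : measurable_fun setT (fun w => (e * h r w)%:E).
  apply/measurable_EFinP; apply: measurable_funM => //.
  by have [/measurable_EFinP] := hP r.
have eh0 r w : (0 <= (e * h r w)%:E)%E by rewrite lee_fin mulr_ge0// ltW.
have inth r : (\int[P]_w (e * h r w)%:E <= (ratio * (e * geom (cdf X r) n))%:E)%E.
  have [mhr _ _ ih] := hP r.
  have -> : (\int[P]_w (e * h r w)%:E = e%:E * \int[P]_w (h r w)%:E)%E.
    under eq_integral do rewrite EFinM.
    by apply: ge0_integralZl_EFin => // [w _|]; rewrite ?lee_fin// ltW.
  rewrite (mulrCA ratio) [leRHS]EFinM; apply: lee_wpmul2l => //.
  by rewrite lee_fin ltW.
rewrite unlock.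
pose S w := (\sum_(j <oo) (e * h (thr e j) w)%:E)%E.
have mS : measurable_fun setT S by apply: ge0_emeasurable_sum.
have S0 w : (0 <= S w)%E by apply: nneseries_ge0.
apply: (@le_trans _ _ (\int[P]_w ((e * h (-1) w)%:E + S w))%E).
  apply: integral_le_ae => //.
  - exact: emeasurable_funD.
  - by move=> w; exact: adde_ge0.
  apply: filterS ae_good => w wgood; apply: alg_le_layers => // r.
  by have [_ _ + _] := hP r; exact.
rewrite ge0_integralD//.
rewrite addeC; apply: leeD; last first.
  apply: le_trans (inth (-1)) _; rewrite lee_fin -mulrA ler_wpM2l//.
  by rewrite mulrC; apply: ler_wpM2r; [exact: ltW|exact: geom_le (cdf_itv X _)].
rewrite /S integral_nneseries//.
apply: (@le_trans _ _ (\sum_(j <oo) (ratio%:E * (e * geom (cdf X (thr e j)) n)%:E))%E).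
  apply: lee_nneseries => [j _ _|j _]; first exact: integral_ge0.
  by rewrite -EFinM; exact: inth.
have g0 r : 0 <= geom (cdf X r) n.
  have /andP[_ v1] := cdf_itv X r.
  by apply: sumr_ge0 => s _; rewrite exprn_ge0// subr_ge0.
rewrite nneseriesZl; last by move=> j _; rewrite lee_fin mulr_ge0// ltW.
rewrite lee_wpmul2l ?lee_fin//.
have mlo r : measurable_fun setT (fun w => (e * layer_opt x r n w)%:E).
  apply/measurable_EFinP; apply: measurable_funM => //.
  exact/measurable_EFinP/measurable_layer_opt.
have lo0 r w : (0 <= (e * layer_opt x r n w)%:E)%E.
  by rewrite lee_fin; apply: mulr_ge0; [exact: ltW|exact: sumr_ge0].
under eq_eseriesr do rewrite EFinM -(integral_layer_opt x_iid).
have -> : (\sum_(j <oo) (e%:E * \int[P]_w (layer_opt x (thr e j) n w)%:E) =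
    \int[P]_w \sum_(j <oo) (e * layer_opt x (thr e j) n w)%:E)%E.
  rewrite integral_nneseries//; apply: eq_eseriesr => j _.
  under [RHS]eq_integral do rewrite EFinM.
  apply/esym/ge0_integralZl_EFin => // [w _||]; last exact: ltW.
  - by rewrite lee_fin; apply: sumr_ge0.
  - exact: measurable_layer_opt.
apply: le_integral_ae.
- by apply: ge0_emeasurable_sum.
- by move=> w; apply: nneseries_ge0.
- by apply: filterS ae_good => w wgood; exact: layer_opt_le_opt.
Qed.

End competitiveness.

Theorem theorem5p3 (R : realType) (d : measure_display) (T : measurableType d)
    (P : probability T R) (X : probability R R) (x : nat -> {RV P >-> R})
    (delta : R -> \bar R)
    (X_continuous : continuous (distribution_function X))
    (X_0 : distribution_function X 0 = 0%E)
    (x_iid : iid X x)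
    (delta_quantile : is_quantile X delta) :
  as_feasible x (algorithm3 delta) /\
  competitive x (algorithm3 delta) (6 + 52 / 1000).
Proof.
split.
  move=> n; apply: filterS (ae_good X_0 x_iid delta_quantile) => w wgood.
  exact: (@algorithm3_feasible _ _ (quantile_mono delta_quantile) n (fun i => x i w)).
rewrite /competitive /limn_esup /limf_esup.
(* The limit superior is at most the supremum over the tail [0 < n], and the quotient is bounded for
   each such [n]. *)
apply: (@le_trans _ _ (ereal_sup [set ('E_P[fun w => alg (algorithm3 delta) n (x^~ w)] /
    'E_P[fun w => opt n (x^~ w)])%E | n in [set n | (0 < n)%N]])).
  by apply: ereal_inf_lbound; exists [set n | (0 < n)%N] => //; exists 1%N.
apply: ge_ereal_sup => _ [n /= n0 <-].
have bnd := fun e => @expectation_bound _ _ _ _ _ _ _ X_0 x_iid delta_quantile n e n0.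
set c := 6 + 52 / 1000 in bnd *; have c0 : 0 < c by rewrite /c; lra.
set Ea := ('E_P[fun w => alg _ _ _])%E in bnd *.
set Eo := ('E_P[_])%E in bnd *.
have Eo0 : (0 <= Eo)%E.
  rewrite /Eo unlock; apply: le_trans (le_integral_ae (f := cst 0%E) _ _ _) => //.
    by rewrite integral0.
  apply: filterS (ae_good X_0 x_iid delta_quantile) => w wgood.
  apply: le_trans (layer_opt_le_opt delta_quantile n ltr01 wgood).
  by apply: nneseries_ge0 => j _ _; rewrite lee_fin mulr_ge0//; exact: sumr_ge0.
(* An infinite denominator has inverse 0, which makes the quotient 0. *)
case: Eo Eo0 bnd => [y| |] // y0 bnd; last by rewrite invey mule0 lee_fin ltW.
have Ea_le : (Ea <= (c * y)%:E)%E.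
  apply/lee_addgt0Pr => e e0.
  have cn0 : 0 < c * n%:R by rewrite mulr_gt0// ltr0n.
  (* With this mesh the rounding term is exactly [e]. *)
  have := bnd (e / (c * n%:R)); rewrite divr_gt0// => /(_ isT).
  by rewrite [c * n%:R * _]mulrC divfK ?gt_eqF// -EFinM.
rewrite inver; case: eqVneq => [yE|yN].
  (* A zero denominator has inverse [+oo], but then [Ea <= 0] and the product is at most 0. *)
  apply: (@le_trans _ _ 0%E); last by rewrite lee_fin ltW.
  by apply: mule_le0_ge0 => //; rewrite (le_trans Ea_le)// yE mulr0.
by rewrite lee_pdivrMr -?EFinM// lt_neqAle eq_sym yN -lee_fin.
Qed.
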